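(* Let $a>0$, let $g_0,g_1\in C^1([0,1])$, and let $\Delta$ be an admissible set of initial conditions for the nonlocal problem (N) (see context). Suppose that there exist constants $\varphi\in(0,\pi)$, $\theta\in(0,\pi-\varphi)$ such that $$\int_0^1|g_0(z)|\sin(\theta+z\varphi)dz<\sin(\theta)\quad\text{and}\quad\int_0^1|g_1(z)|\sin(\theta+z\varphi)dz<\sin(\theta+\varphi).$$ Then there exist constants $M,\delta>0$ such that for every $x_0\in\Delta$ the unique solution $x$ of (N) with initial condition $x_0$ satisfies, for all $t\ge0$, $$\|x[t]\|_\infty\le M e^{-\delta t}\|x[0]\|_\infty,$$ where $\|x[t]\|_\infty:=\max_{0\le z\le1}|x(t,z)|$.
   Context: $\mathbb{R}_+=[0,+\infty)$. For a function $x$ on $\mathbb{R}_+\times[0,1]$, $x[t]$ denotes the profile $z\mapsto x(t,z)$. Problem (N): $\frac{\partial x}{\partial t}(t,z)=a\frac{\partial^2x}{\partial z^2}(t,z)$ for $(t,z)\in(0,+\infty)\times(0,1)$, with nonlocal boundary conditions $x(t,0)=\int_0^1g_0(z)x(t,z)dz$ and $x(t,1)=\int_0^1g_1(z)x(t,z)dz$ for $t\ge 0$. A solution with initial condition $x_0$ is a function $x\in C^0(\mathbb{R}_+\times[0,1])\cap C^1((0,+\infty)\times[0,1])$ satisfying these, with $x[t]\in C^2([0,1])$ for all $t\ge0$ and $x(0,z)=x_0(z)$ for all $z\in[0,1]$. Standing assumption: there exists an admissible set of initial conditions $\Delta$, i.e. a non-empty set $$\Delta\subseteq\left\{x\in C^2([0,1]):x(0)-\int_0^1g_0(z)x(z)dz=x(1)-\int_0^1g_1(z)x(z)dz=0\right\}$$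 which is dense in $L^2$ (i.e. $L^2(0,1)$) and such that for every $x_0\in\Delta$ problem (N) with initial condition $x_0$ has a unique solution. *)

(* Defs.v *)
From mathcomp Require Import all_boot all_order all_algebra.
From mathcomp Require Import all_classical all_reals all_analysis.

Set Implicit Arguments.
Unset Strict Implicit.
Unset Printing Implicit Defensive.

Import Order.TTheory GRing.Theory Num.Theory.
Import numFieldNormedType.Exports.

Local Open Scope classical_set_scope.
Local Open Scope ring_scope.

(* A function on [0,1] (resp. R_+ x [0,1]) is represented by a total function
   of which only the values on [0,1] (resp. R_+ x [0,1]) are ever constrained,
   so derivatives must be taken relative to the domain: they are one-sided at
   the endpoints 0 and 1. *)
Definition is_derive_within (R : realType) (A : set R) (f : R -> R)
    (z l : R) : Prop :=
  (f y - f z) / (y - z) @[y --> within A z^'] --> l.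

Fixpoint Ck (R : realType) (k : nat) (A : set R) (f : R -> R) : Prop :=
  match k with
  | 0%N => {within A, continuous f}
  | k'.+1 => exists2 f' : R -> R,
      forall z, A z -> is_derive_within A f z (f' z) & Ck k' A f'
  end.

Definition C0_closed_strip (R : realType) (x : R -> R -> R) : Prop :=
  {within `[0, +oo[%classic `*` `[0, 1]%classic,
    continuous (fun p : R * R => x p.1 p.2)}.

(* Both first-order partial derivatives exist on (0,+oo) x [0,1] (with respect
   to z they are one-sided at z = 0 and z = 1) and are jointly continuous. *)
Definition C1_open_strip (R : realType) (x : R -> R -> R) : Prop :=
  exists xt xz : R -> R -> R,
    [/\ forall t z : R, 0 < t -> z \in `[0, 1] ->
          is_derive t 1 (x ^~ z) (xt t z) /\
          is_derive_within `[0, 1]%classic (x t) z (xz t z),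
        {within `]0, +oo[%classic `*` `[0, 1]%classic,
          continuous (fun p : R * R => xt p.1 p.2)} &
        {within `]0, +oo[%classic `*` `[0, 1]%classic,
          continuous (fun p : R * R => xz p.1 p.2)}].

Definition pairing (R : realType) (g y : R -> R) : R :=
  \int[@lebesgue_measure R]_(z in `[0, 1]) (g z * y z).

Definition is_solution (R : realType) (a : R) (g0 g1 x0 : R -> R)
    (x : R -> R -> R) : Prop :=
  [/\ C0_closed_strip x /\ C1_open_strip x,
      forall t, 0 <= t -> Ck 2 `[0, 1]%classic (x t),
      forall t z, 0 < t -> z \in `]0, 1[ ->
        (x ^~ z)^`()%classic t = a * (x t)^`(2)%classic z,
      forall t, 0 <= t -> x t 0 = pairing g0 (x t) /\ x t 1 = pairing g1 (x t) &
      forall z, z \in `[0, 1] -> x 0 z = x0 z].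

(* Uniqueness is equality on R_+ x [0,1], see above. *)
Definition has_unique_solution (R : realType) (a : R) (g0 g1 x0 : R -> R) :
    Prop :=
  exists2 x, is_solution a g0 g1 x0 x &
    forall y, is_solution a g0 g1 x0 y ->
      forall t z, 0 <= t -> z \in `[0, 1] -> y t z = x t z.

(* Elements of L^2(0,1) are represented by functions whose extension by zero
   outside ]0,1[ is in L^2 of the line. *)
Definition dense_in_L2 (R : realType) (D : set (R -> R)) : Prop :=
  forall f : R -> R, f \_ `]0, 1[%classic \in Lfun lebesgue_measure 2%:E ->
  forall e : R, 0 < e -> exists2 y, D y &
    (Lnorm lebesgue_measure 2%:E
       (EFin \o ((f \- y)%R \_ `]0%R, 1%R[%classic)) < e%:E)%E.

Definition admissible (R : realType) (a : R) (g0 g1 : R -> R)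
    (Delta : set (R -> R)) : Prop :=
  [/\ Delta !=set0,
      forall y, Delta y ->
        [/\ Ck 2 `[0, 1]%classic y,
            y 0 - pairing g0 y = 0 & y 1 - pairing g1 y = 0],
      dense_in_L2 Delta &
      forall x0, Delta x0 -> has_unique_solution a g0 g1 x0].

(* For f continuous on [0,1] this supremum is attained, so it is the maximum. *)
Definition supnorm (R : realType) (f : R -> R) : R :=
  sup [set `|f z| | z in `[0, 1]%classic].

(* Main.v *)
Require Import Defs.
From mathcomp Require Import all_boot all_order all_algebra.
From mathcomp Require Import all_classical all_reals all_analysis.
From mathcomp Require Import ring lra.

Import Order.TTheory GRing.Theory Num.Theory.
Import numFieldNormedType.Exports.

Local Open Scope classical_set_scope.
Local Open Scope ring_scope.

(** The proof is a maximum principle with an explicit barrier.  Put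
    [w z = sin (theta + z phi)], which is positive on [[0, 1]], and
    [V t z = C e^(- d t) w z] with [d < a phi^2].  Since [w'' = - phi^2 w],
    the function [V] is a strict supersolution of the heat equation:
    [V_t - a V_zz = (a phi^2 - d) V > 0].  The two integral hypotheses say that
    [V] is also a strict supersolution of the nonlocal boundary conditions:
    [\int |g0| V < V t 0] and [\int |g1| V < V t 1].

    Suppose that a solution starts with [|x 0 z| < C w z].  If [|x|] ever
    reached [V], there would be a first time [T > 0] of contact
    ([first_contact]).
    At time [T] one has [|x| <= V] everywhere, with equality at some [c].
    If [c] is an endpoint, then [|x T c|] is bounded by the integral of [|g_i| V],
    which is smaller than [V T c] ([pairing_lt]).
    If [c] is interior, then with [s] the sign of [x T c] the function
    [s x - V] has a spatial maximum at [c], so [s x_zz <= V_zz]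
    ([second_derive_at_max_le0]), and it is maximal at [T] among earlier times,
    so [s x_t >= V_t] ([derive_at_left_max_ge0]).  The heat equation then gives
    [V_t <= a V_zz], contrary to the strict inequality above.
    Both cases are excluded in [solution_below_barrier].

    The theorem follows with [delta = a phi^2 / 2] and [M = 1 / min w], by
    taking [C] slightly larger than [M] times the norm of [x 0] and letting the excess tend
    to [0]. *)

(** * Relative derivatives *)

Lemma is_derive_of_within (R : realType) (A : set R) (f : R -> R) (z l : R) :
  nbhs z A -> is_derive_within A f z l -> is_derive z 1 f l.
Proof.
move=> Az fl.
suff H : h^-1 *: ((f \o shift z) (h *: 1) - f z) @[h --> 0^'] --> l.
  by apply: DeriveDef; [exact: cvgP H|exact: cvg_lim H].
apply/cvgrPdist_lt => e e0.
move/cvgrPdist_lt : fl => /(_ e e0).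
rewrite near_withinE => fl.
have {}fl : \forall y \near z^', `|l - (f y - f z) / (y - z)| < e.
  move: fl; apply: filter_app.
  have : \forall y \near z^', A y by apply: nbhs_dnbhs.
  by apply: filterS => y Ay /(_ Ay).
case: fl => d /= d0 H; exists d => //= h; rewrite /= sub0r normrN => hd h0.
have := H (h + z); rewrite /= opprD addrCA subrr addr0 normrN => /(_ hd).
rewrite [h *: 1]mulr1 addrK mulrC; apply.
by rewrite -subr_eq0 addrK.
Qed.

(** Away from [z], [f y] is [f z] plus the difference quotient times [y - z],
    and the quotient has a finite limit. *)
Lemma continuous_of_is_derive_within (R : realType) (A : set R) (f f' : R -> R) :
  (forall z, A z -> is_derive_within A f z (f' z)) ->
  {within A, continuous f}.
Proof.
move=> df; apply/subspace_continuousP => z Az.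
have : f y @[y --> within A z^'] --> f z.
  have -> : f z = f' z * (z - z) + f z by rewrite subrr mulr0 add0r.
  have : (f y - f z) / (y - z) * (y - z) + f z @[y --> within A z^'] -->
      f' z * (z - z) + f z.
    apply: cvgD; last exact: cvg_cst.
    apply: cvgM; first exact: df.
    apply: cvgB; last exact: cvg_cst.
    by apply: cvg_within_filter; apply: cvg_within_filter; exact: cvg_id.
  apply: cvg_trans; apply: near_eq_cvg.
  rewrite !near_withinE; near=> y => yz _.
  by rewrite divfK ?subrK// subr_eq0.
move=> /cvgrPdist_lt fz; apply/cvgrPdist_lt => e e0.
have := fz e e0; rewrite !near_withinE.
apply: filterS => y H Ay.
by have [->|/H/(_ Ay)//] := eqVneq y z; rewrite subrr normr0.
Unshelve. all: by end_near. Qed.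

Lemma continuous_of_is_derive (R : realType) (f : R -> R) (z l : R) :
  is_derive z 1 f l -> {for z, continuous f}.
Proof. by case=> + _; rewrite derivable1_diffP; exact: differentiable_continuous. Qed.

(** A one-sided [C^2] function has, inside the interval, the ordinary iterated
    derivative in which the heat equation is written.  The first derivative is
    needed on a whole neighbourhood, for the mean value theorem. *)
Lemma derive1n2_of_Ck2 (R : realType) (a b z : R) (f : R -> R) :
  z \in `]a, b[ -> Ck 2 `[a, b] f ->
  exists f' : R -> R,
  (forall y, y \in `]a, b[ -> is_derive y 1 f (f' y)) /\
  is_derive z 1 f' (f^`(2)%classic z).
Proof.
move=> zab [f' df [f'' ddf _]]; exists f'.
have nab y : y \in `]a, b[ -> nbhs y `[a, b]%classic.
  move=> yab; apply: (filterS _ (near_in_itvoo yab)) => u /=.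
  exact: subset_itv_oo_cc.
have sub y : y \in `]a, b[ -> `[a, b]%classic y by exact: subset_itv_oo_cc.
have df' y : y \in `]a, b[ -> is_derive y 1 f (f' y).
  by move=> yab; exact: is_derive_of_within _ _ _ _ _ (nab _ yab) (df _ (sub _ yab)).
have ddf' : is_derive z 1 f' (f'' z).
  exact: is_derive_of_within _ _ _ _ _ (nab _ zab) (ddf _ (sub _ zab)).
split => //.
suff H : is_derive z 1 (f^`()%classic) (f'' z).
  by rewrite derive1nS derive1n1 derive1E (@derive_val _ _ _ _ _ _ _ H).
(* f^`() agrees with f' only inside the interval, which is enough near z. *)
apply: near_eq_is_derive ddf'.
apply: (filterS _ (near_in_itvoo zab)) => y yab.
by rewrite derive1E (@derive_val _ _ _ _ _ _ _ (df' _ yab)).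
Qed.

(** * Maxima and first contact times *)

(** If [l] were positive then, since [f' c = 0], [f'] would be positive just to
    the right of [c], and by the mean value theorem [f] would exceed [f c]. *)
Lemma second_derive_at_max_le0 (R : realType) (a b c l : R) (f f' : R -> R) :
  c \in `]a, b[ ->
  (forall z, z \in `]a, b[ -> is_derive z 1 f (f' z)) ->
  is_derive c 1 f' l ->
  (forall z, z \in `]a, b[ -> f z <= f c) -> l <= 0.
Proof.
move=> cab df ddf fmax.
have [ac cb] : a < c /\ c < b by split; rewrite (itvP cab).
have f'c0 : f' c = 0.
  have H := derive1_at_max (ltW (lt_trans ac cb))
    (fun z zab => @ex_derive _ _ _ _ _ _ _ (df z zab)) cab fmax.
  by rewrite -(@derive_val _ _ _ _ _ _ _ (df c cab)) (@derive_val _ _ _ _ _ _ _ H).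
rewrite leNgt; apply/negP => l0.
have /cvgr_gt : h^-1 *: ((f' \o shift c) (h *: 1) - f' c) @[h --> 0^'+] --> l.
  case: ddf => + <-; rewrite /derive/= => ddf.
  exact: cvg_dnbhs_at_right.
move=> /(_ _ l0); rewrite near_withinE => -[e /= e0 He].
have {}He y : c < y -> y < c + e -> 0 < f' y.
  move=> cy yc; have yc0 : 0 < y - c by rewrite subr_gt0.
  have := He (y - c); rewrite /= distrC subr0 gtr0_norm// ltrBlDl => /(_ yc yc0).
  by rewrite f'c0 subr0 [_ *: 1]mulr1 subrK pmulr_rgt0 ?invr_gt0.
have [b' [cb' b'b b'e]] : exists b', [/\ c < b', b' < b & b' <= c + e].
  exists (Num.min ((c + b) / 2) (c + e)).
  by rewrite lt_min gt_min ge_min midf_lt// midf_lt//= ltrDl e0 lexx orbT.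
have sub z : z \in `[c, b'] -> z \in `]a, b[.
  move=> zcb; rewrite in_itv/= (lt_le_trans ac) ?(itvP zcb)//=.
  by rewrite (le_lt_trans _ b'b) ?(itvP zcb).
have dfcb z : z \in `]c, b'[ -> is_derive z 1 f (f' z).
  by move=> zcb; apply/df/sub; exact: subset_itv_oo_cc.
have fcont : {within `[c, b'], continuous f}.
  by apply: derivable_within_continuous => z /sub/df dfz; case: dfz.
have [d dcb' fE] := MVT cb' dfcb fcont.
have : f c < f b'.
  rewrite -subr_gt0 fE mulr_gt0 ?subr_gt0// He ?(itvP dcb')//.
  by rewrite (lt_le_trans _ b'e)// (itvP dcb').
by rewrite ltNge fmax// sub// in_itv/= (ltW cb') lexx.
Qed.

(** The difference quotients with a small negative increment are nonnegative. *)
Lemma derive_at_left_max_ge0 (R : realType) (k : R -> R) (a c l : R) :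
  a < c -> (forall t, t \in `]a, c[ -> k t <= k c) -> is_derive c 1 k l ->
  0 <= l.
Proof.
move=> ac kmax dk.
have kl : h^-1 *: ((k \o shift c) (h *: 1) - k c) @[h --> 0^'-] --> l.
  case: dk => + <-; rewrite /derive/= => dk.
  exact: cvg_dnbhs_at_left.
have /cvg_lim <- // := kl.
apply: limr_ge; first exact: cvgP kl.
rewrite near_withinE; exists (c - a); rewrite /= ?subr_gt0// => h.
rewrite /= sub0r normrN => hac h0.
rewrite [_ *: 1]mulr1 nmulr_rge0 ?invr_lt0// subr_le0 kmax// in_itv/= gtrDr h0 andbT.
by rewrite -ltrBlDr -opprB ltrNl (le_lt_trans _ hac)// -normrN ler_norm.
Qed.

(** [F] is only continuous relative to [K], so the half-line is pulled back not
    along [F] but on the compact image of [p |-> (p.1, F p)], where it cuts out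
    a closed half-plane. *)
Lemma first_contact (R : realType) (K : set (R * R)) (F : R * R -> R) :
  compact K -> {within K, continuous F} -> (exists2 p, K p & 0 <= F p) ->
  exists p, [/\ K p, 0 <= F p & forall q, K q -> 0 <= F q -> p.1 <= q.1].
Proof.
move=> cK cF [p0 Kp0 Fp0].
pose G p := (p.1, F p) : R * R.
have cG : compact (G @` K `&` (snd @^-1` [set y | 0 <= y])).
  apply: compact_closedI; last first.
    by apply: closed_comp => [? _|]; [exact: cvg_snd|exact: closed_ge].
  apply: continuous_compact => //.
  move/subspace_continuousP : cF => cF; apply/subspace_continuousP => p Kp.
  have fstc : fst q @[q --> within K (nbhs p)] --> p.1.
    by apply: cvg_within_filter; exact: cvg_fst.
  exact: cvg_pair fstc (cF p Kp).
have [] := @compact_EVT_min _ R (fst : R * R -> R) _ _ cG.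
- by exists (G p0); split => //; exists p0.
- by apply: continuous_subspaceT => p; exact: cvg_fst.
- move=> _ /set_mem[[p Kp <-]] /= Fp H; exists p; split => // q Kq Fq.
  by apply: (H (G q)); apply/mem_set; split => //; exists q.
Qed.


(** * The barrier *)

Lemma is_derive_affine (R : realType) (theta phi z : R) :
  is_derive z 1 (fun y => theta + y * phi) phi.
Proof.
have -> : (fun y => theta + y * phi) = cst theta + phi *: id.
  by apply/funext => y; rewrite /= !fctE mulrC.
have := is_deriveD (is_derive_cst theta z 1) (is_deriveZ phi (is_derive_id z 1)).
by rewrite add0r [phi *: 1]mulr1.
Qed.

Lemma is_derive_sin_affine (R : realType) (theta phi z : R) :
  is_derive z 1 (fun y => sin (theta + y * phi)) (phi * cos (theta + z * phi)).
Proof.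
have dg := is_derive_affine R theta phi z.
have df := is_derive_sin (theta + z * phi).
have := @is_derive1_comp R sin (fun y => theta + y * phi) z _ _ df dg.
by rewrite mulrC.
Qed.

Lemma is_derive_cos_affine (R : realType) (theta phi z : R) :
  is_derive z 1 (fun y => cos (theta + y * phi)) (- (phi * sin (theta + z * phi))).
Proof.
have dg := is_derive_affine R theta phi z.
have df := is_derive_cos (theta + z * phi).
have := @is_derive1_comp R cos (fun y => theta + y * phi) z _ _ df dg.
by rewrite mulrC mulrN.
Qed.

Lemma is_derive_expR_scale (R : realType) (d t : R) :
  is_derive t 1 (fun u => expR (d * u)) (d * expR (d * t)).
Proof.
have -> : (fun u => expR (d * u)) = (fun u => expR (0 + u * d)).
  by apply/funext => u; rewrite add0r mulrC.
have dg := is_derive_affine R 0 d t.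
have df := is_derive_expR (0 + t * d).
have := @is_derive1_comp R expR (fun y => 0 + y * d) t _ _ df dg.
by rewrite add0r mulrC [t * d]mulrC.
Qed.

Lemma is_deriveB_scale (R : realType) (f g : R -> R) (s k z df dg : R) :
  is_derive z 1 f df -> is_derive z 1 g dg ->
  is_derive z 1 (fun y => s * f y - k * g y) (s * df - k * dg).
Proof.
move=> hf hg.
have -> : (fun y => s * f y - k * g y) = s *: f - k *: g by [].
by apply: is_derive_eq.
Qed.

(** When [k w] dominates [|y|], the nonlocal boundary value of [y] falls strictly
    short of the boundary value [k c] of the barrier. *)
Lemma pairing_lt (R : realType) (g y w : R -> R) (k c : R) :
  {within `[0, 1], continuous g} -> {within `[0, 1], continuous y} ->
  {within `[0, 1], continuous w} -> 0 < k ->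
  (forall z, z \in `[0, 1] -> `|y z| <= k * w z) ->
  \int[@lebesgue_measure R]_(z in `[0, 1]) (`|g z| * w z) < c ->
  `|pairing g y| < k * c.
Proof.
move=> cg cy cw k0 yw hc.
have intC (f : R -> R) : {within `[0, 1], continuous f} ->
    (@lebesgue_measure R).-integrable `[0, 1] (EFin \o f).
  by move=> cf; apply: continuous_compact_integrable => //; exact: segment_compact.
have cgy : {within `[0, 1], continuous (fun z => g z * y z)}.
  by move=> z; apply: cvgM; [exact: cg|exact: cy].
have cgw : {within `[0, 1], continuous (fun z => `|g z| * w z)}.
  by move=> z; apply: cvgM; [apply: cvg_norm; exact: cg|exact: cw].
have ckgw : {within `[0, 1], continuous (fun z => k * (`|g z| * w z))}.
  by move=> z; apply: cvgM; [exact: cvg_cst|exact: cgw].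
have cngy : {within `[0, 1], continuous (fun z => `|g z * y z|)}.
  by move=> z; apply: cvg_norm; exact: cgy.
have mI : @measurable _ (measurableTypeR R) `[0, 1]%classic by exact: measurable_itv.
apply: (le_lt_trans (le_normr_Rintegral mI (intC _ cgy))).
apply: (@le_lt_trans _ _ (\int[@lebesgue_measure R]_(z in `[0, 1]) (k * (`|g z| * w z)))).
  apply: le_Rintegral => //; [exact: intC|exact: intC|].
  by move=> z z01; rewrite normrM mulrCA ler_wpM2l// yw.
by rewrite RintegralZl// ?ltr_pM2l//; exact: intC.
Qed.

(** The strictness of all three supersolution inequalities for the barrier makes
    a first contact impossible: see the two endpoint cases [c_neq0], [c_neq1]
    and the interior inequalities [time] and [space]. *)
Lemma solution_below_barrier (R : realType) (a : R) (g0 g1 x0 : R -> R)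
    (x : R -> R -> R) (phi theta C d : R) :
  0 < a -> 0 < C -> d < a * phi ^+ 2 ->
  {within `[0, 1], continuous g0} -> {within `[0, 1], continuous g1} ->
  (forall z, z \in `[0, 1] -> 0 < sin (theta + z * phi)) ->
  \int[@lebesgue_measure R]_(z in `[0, 1])
    (`|g0 z| * sin (theta + z * phi)) < sin theta ->
  \int[@lebesgue_measure R]_(z in `[0, 1])
    (`|g1 z| * sin (theta + z * phi)) < sin (theta + phi) ->
  is_solution a g0 g1 x0 x ->
  (forall z, z \in `[0, 1] -> `|x 0 z| < C * sin (theta + z * phi)) ->
  forall t z, 0 <= t -> z \in `[0, 1] ->
    `|x t z| < C * expR (- d * t) * sin (theta + z * phi).
Proof.
move=> a0 C0 da cg0 cg1 wpos hg0 hg1 [[cx [xt [xz [dx _ _]]]] x2 heat bc _].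
move=> init t1 z1 t10 z101; rewrite ltNge; apply/negP => contact.
pose w z := sin (theta + z * phi).
pose V t z := C * expR (- d * t) * w z.
pose F (p : R * R) := `|x p.1 p.2| - V p.1 p.2.
pose K : set (R * R) := `[0, t1]%classic `*` `[0, 1]%classic.
have cw z : {for z, continuous w}.
  exact: continuous_of_is_derive (is_derive_sin_affine _ theta phi z).
have ce t : {for t, continuous (fun u => expR (- d * u))}.
  exact: continuous_of_is_derive (is_derive_expR_scale _ (- d) t).
have cK : compact K by apply: compact_setX; exact: segment_compact.
have cF : {within K, continuous F}.
  have KS : K `<=` `[0, +oo[%classic `*` `[0, 1]%classic.
    move=> [t z] [/= t01 z01]; split => //=.
    by rewrite in_itv/= (itvP t01).
  have cxK := continuous_subspaceW KS cx.
  have cV : {within K, continuous (fun p : R * R => V p.1 p.2)}.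
    apply: continuous_subspaceT => p; apply: cvgM; first apply: cvgM.
    - exact: cvg_cst.
    - apply: (@cvg_comp _ _ _ fst (fun u => expR (- d * u))); first exact: cvg_fst.
      exact: ce.
    - by apply: (@cvg_comp _ _ _ snd w); [exact: cvg_snd|exact: cw].
  by move=> p; apply: cvgB; [apply: cvg_norm; exact: cxK|exact: cV].
have [|[T c] [[/= T01 c01]]] := first_contact _ _ _ cK cF.
  by exists (t1, z1); rewrite /F ?subr_ge0//; split; rewrite //= in_itv/= lexx t10.
rewrite subr_ge0 /= => FT first.
have T0 : 0 < T.
  rewrite lt_neqAle (itvP T01) andbT; apply/eqP => T0; move: FT.
  by rewrite -T0 /V mulr0 expR0 mulr1 leNgt init.
have before t z : 0 <= t -> t < T -> z \in `[0, 1] -> `|x t z| < V t z.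
  move=> t0 tT z01; rewrite ltNge; apply/negP => Vx.
  suff : T <= t by rewrite leNgt tT.
  apply: (first (t, z)); last by rewrite /F subr_ge0.
  by split; rewrite //= in_itv/= t0 (le_trans (ltW tT))// (itvP T01).
(* Continuity at T in the variable t comes from the C1 regularity, as T > 0. *)
have atT z : z \in `[0, 1] -> `|x T z| <= V T z.
  move=> z01; have [xTz _] := dx T z T0 z01.
  have cxz := continuous_of_is_derive _ _ _ _ xTz.
  have : V t z - `|x t z| @[t --> T^'-] --> V T z - `|x T z|.
    apply: cvg_at_left_filter; apply: cvgB; last by apply: cvg_norm; exact: cxz.
    by apply: cvgM; [apply: cvgM; [exact: cvg_cst|exact: ce]|exact: cvg_cst].
  move=> kT; rewrite -subr_ge0 -(cvg_lim _ kT)//.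
  apply: limr_ge; first exact: cvgP kT.
  near=> t; rewrite subr_ge0 ltW// before//.
  by apply: ltW; near: t; exact: nbhs_left_gt.
have VTc : `|x T c| = V T c by apply/le_anti; rewrite atT.
pose k := C * expR (- d * T).
have k0 : 0 < k by rewrite mulr_gt0 ?expR_gt0.
have cxT : {within `[0, 1], continuous (x T)}.
  have [x' dx' _] := x2 T (ltW T0).
  exact: continuous_of_is_derive_within _ _ _ _ dx'.
have cwI : {within `[0, 1], continuous w} by apply: continuous_subspaceT.
have c_neq0 : c != 0.
  apply/eqP => c0; have := pairing_lt _ _ _ _ _ _ cg0 cxT cwI k0 atT hg0.
  by have [<- _] := bc T (ltW T0); rewrite -{1}c0 VTc c0 /V /w mul0r addr0 ltxx.
have c_neq1 : c != 1.
  apply/eqP => c1; have := pairing_lt _ _ _ _ _ _ cg1 cxT cwI k0 atT hg1.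
  by have [_ <-] := bc T (ltW T0); rewrite -{1}c1 VTc c1 /V /w mul1r ltxx.
have coo : c \in `]0, 1[.
  by rewrite in_itv/= !lt_neqAle eq_sym c_neq0 c_neq1/= !(itvP c01).
(* The sign removes the absolute value at the contact point, and s x <= |x|
   keeps the comparison with V everywhere else. *)
pose s := Num.sg (x T c).
have sx t z : s * x t z <= `|x t z|.
  rewrite (le_trans (ler_norm _))// normrM ler_piMl// normr_sg.
  by rewrite lern1 leq_b1.
have sxT : s * x T c = k * w c by rewrite -normrEsg VTc.
have [dxt _] := dx T c T0 c01.
have time : 0 <= s * xt T c - C * w c * (- d * expR (- d * T)).
  pose h t := s * x t c - C * w c * expR (- d * t).
  have dh := is_deriveB_scale _ _ _ s (C * w c) _ _ _ dxt
    (is_derive_expR_scale _ (- d) T).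
  apply: (derive_at_left_max_ge0 _ h _ _ _ T0 _ dh).
  have -> : h T = 0 by rewrite /h sxT /k mulrAC subrr.
  move=> t t0T; rewrite /h subr_le0 (le_trans (sx _ _))//.
  by rewrite mulrAC ltW// before// (itvP t0T).
have [x' [dx' ddx']] := derive1n2_of_Ck2 _ _ _ _ _ coo (x2 T (ltW T0)).
have space : s * (x T)^`(2)%classic c - (k * phi) * - (phi * sin (theta + c * phi)) <= 0.
  pose f z := s * x T z - k * w z.
  pose f' z := s * x' z - k * phi * cos (theta + z * phi).
  apply: (second_derive_at_max_le0 _ _ _ _ _ f f' coo).
  - move=> z z01; rewrite /f' -mulrA.
    exact: is_deriveB_scale (dx' _ z01) (is_derive_sin_affine _ theta phi z).
  - exact: is_deriveB_scale ddx' (is_derive_cos_affine _ theta phi c).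
  - move=> z z01; rewrite /f sxT subrr subr_le0 (le_trans (sx _ _))// atT//.
    exact: subset_itv_oo_cc.
have xtE : xt T c = a * (x T)^`(2)%classic c.
  by rewrite -heat// derive1E (@derive_val _ _ _ _ _ _ _ dxt).
have kw : 0 < k * w c by rewrite mulr_gt0// wpos.
have : 0 < (a * phi ^+ 2 - d) * (k * w c) by rewrite mulr_gt0 ?subr_gt0.
move: time; rewrite xtE.
have -> : C * w c * (- d * expR (- d * T)) = - d * (k * w c) by rewrite /k; ring.
move: space; rewrite -/(w c) -(ler_pM2l a0).
have -> : a * (s * (x T)^`(2)%classic c - k * phi * - (phi * w c)) =
  s * (a * (x T)^`(2)%classic c) + a * phi ^+ 2 * (k * w c) by ring.
by lra.
Unshelve. all: by end_near. Qed.

(** * Exponential decay *)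

Theorem theorem3p1 (R : realType) (a : R) (g0 g1 : R -> R)
    (Delta : set (R -> R)) (phi theta : R)
    (a_gt0 : 0 < a)
    (g0_C1 : Ck 1 `[0, 1]%classic g0)
    (g1_C1 : Ck 1 `[0, 1]%classic g1)
    (Delta_adm : admissible a g0 g1 Delta)
    (phi_bnd : 0 < phi < pi)
    (theta_bnd : 0 < theta < pi - phi)
    (hg0 : \int[@lebesgue_measure R]_(z in `[0, 1])
             (`|g0 z| * sin (theta + z * phi)) < sin theta)
    (hg1 : \int[@lebesgue_measure R]_(z in `[0, 1])
             (`|g1 z| * sin (theta + z * phi)) < sin (theta + phi)) :
  exists M delta : R,
    [/\ 0 < M, 0 < delta &
        forall (x0 : R -> R) (x : R -> R -> R),
          Delta x0 -> is_solution a g0 g1 x0 x ->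
          forall t : R, 0 <= t ->
            supnorm (x t) <= M * expR (- delta * t) * supnorm (x 0)].
Proof.
pose w z := sin (theta + z * phi).
have [phi0 phipi] := andP phi_bnd; have [th0 thpi] := andP theta_bnd.
have wpos z : z \in `[0, 1] -> 0 < w z.
  rewrite in_itv/= => /andP[z0 z1]; apply: sin_gt0_pi.
  have := mulr_ge0 z0 (ltW phi0); have : z * phi <= phi by rewrite ler_piMl// ltW.
  by move=> ? ?; apply/andP; split; lra.
have cw : {within `[0, 1], continuous w}.
  apply: continuous_subspaceT => z.
  exact: continuous_of_is_derive (is_derive_sin_affine _ theta phi z).
have [c /wpos wc0 wmin] := EVT_min ler01 cw.
have cg0 : {within `[0, 1], continuous g0}.
  by have [g' dg _] := g0_C1; exact: continuous_of_is_derive_within _ _ _ _ dg.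
have cg1 : {within `[0, 1], continuous g1}.
  by have [g' dg _] := g1_C1; exact: continuous_of_is_derive_within _ _ _ _ dg.
have aphi0 : 0 < a * phi ^+ 2 by rewrite mulr_gt0// exprn_gt0.
pose d := a * phi ^+ 2 / 2.
exists (w c)^-1, d; split; [by rewrite invr_gt0|by rewrite divr_gt0|].
move=> x0 x _ solx t t0.
have bnd0 z : z \in `[0, 1] -> `|x 0 z| <= supnorm (x 0).
  have [_ x2 _ _ _] := solx; have [x' dx' _] := x2 0 (lexx 0).
  have cx0 : {within `[0, 1], continuous (fun z => `|x 0 z|)}.
    have cx := continuous_of_is_derive_within _ _ _ _ dx'.
    by move=> y; apply: cvg_norm; exact: cx.
  move=> z01; apply: ub_le_sup; last by exists z.
  have [m _ mmax] := EVT_max ler01 cx0.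
  by exists `|x 0 m| => _ [y y01 <-]; exact: mmax.
apply: ge_sup; first by exists `|x t 0|, 0 => //=; rewrite in_itv/= lexx ler01.
move=> _ [z z01 <-].
have S0 : 0 <= supnorm (x 0) by apply: le_trans (bnd0 z z01).
have E0 : 0 < (w c)^-1 * expR (- d * t) by rewrite mulr_gt0 ?invr_gt0 ?expR_gt0.
apply/ler_addgt0Pr => e e0.
(* The excess over the initial norm is tuned so that it contributes exactly e
   to the bound at time t. *)
pose C := (w c)^-1 * (supnorm (x 0) + e / ((w c)^-1 * expR (- d * t))).
have S1 : supnorm (x 0) < supnorm (x 0) + e / ((w c)^-1 * expR (- d * t)).
  by rewrite ltrDl divr_gt0.
have C0 : 0 < C by rewrite mulr_gt0 ?invr_gt0// (le_lt_trans S0).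
have init y : y \in `[0, 1] -> `|x 0 y| < C * w y.
  move=> y01; rewrite (le_lt_trans (bnd0 _ y01))// (lt_le_trans S1)//.
  rewrite /C mulrAC ler_peMl ?(le_trans S0 (ltW S1))//.
  by rewrite mulrC ler_pdivlMr// mul1r wmin.
have da : d < a * phi ^+ 2 by rewrite /d; lra.
have := solution_below_barrier _ _ _ _ _ _ _ _ _ _ a_gt0 C0 da cg0 cg1 wpos
  hg0 hg1 solx init t z t0 z01.
move=> /ltW/le_trans; apply.
apply: (@le_trans _ _ (C * expR (- d * t))).
  by rewrite ler_piMr ?sin_le1// mulr_ge0 ?expR_ge0// ltW.
by rewrite /C mulrAC mulrDr [X in _ + X]mulrC divfK// gt_eqF.
Qed.
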